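(* Let $K$ be an algebraic number field with ring of integers $\mathbb{Z}_K$ and let $p$ be a prime. A full lattice $I$ in $K$ is the $p$-radical of some order in $K$ if and only if \[ p\mathbb{Z} + I^2 \subseteq I \subseteq J_p(\mathbb{Z}_K). \] Suppose these inclusions hold. Let $\mathcal{O}_I$ be the suborder of $M(I)$ containing $I$ such that $\mathcal{O}_I/I$ is the largest semisimple subring of the finite ring $M(I)/I$. Then: (1) The orders $\mathbb{Z}+I$ and $\mathcal{O}_I$ both have $p$-radical $I$, and $M(I)/J_p(M(I)) \cong \mathcal{O}_I/I$. (2) An order $\mathcal{O}$ in $K$ has $p$-radical $I$ if and only if $\mathbb{Z}+I \subseteq \mathcal{O} \subseteq \mathcal{O}_I$. In particular, the orders in $K$ with $p$-radical $I$ form a lattice (in the order-theoretic sense) with respect to inclusion.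
   Context: A lattice in $K$ is a finitely generated $\mathbb{Z}$-submodule of $K$; it is full if it contains a $\mathbb{Q}$-basis of $K$. An order in $K$ is a subring (with $1$) that is a full lattice. For full lattices $I,J$ the product $IJ$ is the $\mathbb{Z}$-module generated by all products $ij$ with $i\in I$, $j\in J$. The multiplicator ring of a full lattice $I$ is the order $M(I)=\{x\in K \mid xI\subseteq I\}$. For an order $\mathcal{O}$, the $p$-radical $J_p(\mathcal{O})$ is the intersection of the prime ideals of $\mathcal{O}$ containing $p$. A finite commutative ring $R$ of prime characteristic $p$ has a largest semisimple subring (it contains every semisimple subring of $R$); it is the image of $x\mapsto x^{p^e}$ for any $e\ge 1$ such that the $p^e$-th power of the Jacobson radical of $R$ is zero. *)

(* Defs.v *)
From HB Require Import structures.
From mathcomp Require Import all_boot all_order all_algebra all_field.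
From mathcomp Require Import boolp.

Set Implicit Arguments.
Unset Strict Implicit.
Unset Printing Implicit Defensive.

Import GRing.Theory.

Local Open Scope ring_scope.
Local Open Scope quotient_scope.

(* Subsets are boolean predicates; [`[< P >]] (boolp) turns an arbitrary      *)
(* proposition into a boolean, so classically these are all subsets.          *)

Record subring_of (R : comPzRingType) (A : subringClosed R) : predArgType :=
  SubringOf { subring_val : R; _ : subring_val \in A }.

HB.instance Definition _ (R : comPzRingType) (A : subringClosed R) :=
  [isSub for @subring_val R A].
HB.instance Definition _ (R : comPzRingType) (A : subringClosed R) :=
  [Choice of subring_of A by <:].
HB.instance Definition _ (R : comPzRingType) (A : subringClosed R) :=
  GRing.SubChoice_isSubComPzRing.Build _ _ (subring_of A) (subringClosedP A).
HB.instance Definition _ (R : comNzRingType) (A : subringClosed R) :=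
  GRing.SubPzSemiRing_isNonZero.Build _ _ (subring_of A).

(* MathComp's [idealr] only covers proper ideals; here the unit ideal is      *)
(* allowed, and the quotient may be the zero ring.                            *)
HB.mixin Record isMulAbsorbing (R : comPzRingType) (S : R -> bool) := {
  absorbM : forall a u : R, u \in (S : {pred R}) -> a * u \in (S : {pred R})
}.

#[short(type="ideal")]
HB.structure Definition Ideal (R : comPzRingType) :=
  {S of GRing.ZmodClosed R S & isMulAbsorbing R S}.

Definition quot_ring (R : comPzRingType) (J : ideal R) := Quotient.quot J.

Section QuotRing.
Variables (R : comPzRingType) (J : ideal R).
Local Notation Q := (quot_ring J).

HB.instance Definition _ := EqQuotient.on Q.
HB.instance Definition _ := GRing.Zmodule.on Q.

Definition quot_one : Q := \pi_Q 1.
Definition quot_mul (x y : Q) : Q := \pi_Q (repr x * repr y).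

Lemma quot_piP (x y : R) : (\pi_Q x = \pi_Q y) <-> (x - y \in (J : {pred R})).
Proof. by rewrite Quotient.idealrBE; split=> [/eqP|/eqP]. Qed.

Lemma quot_piM (x y : R) : \pi_Q (x * y) = quot_mul (\pi_Q x) (\pi_Q y).
Proof.
have hx : x - repr (\pi_Q x) \in (J : {pred R}) by apply/quot_piP; rewrite reprK.
have hy : y - repr (\pi_Q y) \in (J : {pred R}) by apply/quot_piP; rewrite reprK.
apply/quot_piP; set x' := repr _ in hx *; set y' := repr _ in hy *.
have -> : x * y - x' * y' = y * (x - x') + x' * (y - y').
  by rewrite !mulrBr addrA [y * x']mulrC subrK [y * x]mulrC.
by rewrite rpredD //; apply: absorbM.
Qed.

Fact quot_mulA : associative quot_mul.
Proof.
move=> x y z; rewrite -[x]reprK -[y]reprK -[z]reprK.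
rewrite -(quot_piM (repr y)) -(quot_piM (repr x) (repr y)).
by rewrite -(quot_piM _ (_ * _)) -(quot_piM (_ * _)) mulrA.
Qed.

Fact quot_mulC : commutative quot_mul.
Proof. by move=> x y; rewrite /quot_mul mulrC. Qed.

Fact quot_mul1 : left_id quot_one quot_mul.
Proof. by move=> x; rewrite -[x]reprK -quot_piM mul1r. Qed.

Lemma quot_piD (x y : R) : \pi_Q (x + y) = \pi_Q x + \pi_Q y.
Proof. exact: (raddfD \pi_(Quotient.quot J)). Qed.

Fact quot_mulDl : left_distributive quot_mul +%R.
Proof.
move=> x y z; rewrite -[x]reprK -[y]reprK -[z]reprK.
by rewrite -quot_piD -!quot_piM -quot_piD mulrDl.
Qed.

HB.instance Definition _ := GRing.Zmodule_isComPzRing.Build Q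
  quot_mulA quot_mulC quot_mul1 quot_mulDl.

End QuotRing.

Definition simple_ideal (R : comPzRingType) (J : ideal R) : Prop :=
  (exists2 x, x \in J & x != 0) /\
  forall J' : ideal R, {subset J' <= J} ->
    (forall x, x \in J' -> x = 0) \/ {subset J <= J'}.

(* R, as a module over itself, is a finite direct sum of simple submodules.   *)
Definition semisimple (R : comPzRingType) : Prop :=
  exists (n : nat) (J : 'I_n -> ideal R),
    (forall i, simple_ideal (J i)) /\
    forall x : R, exists! f : {ffun 'I_n -> R},
      (forall i, f i \in J i) /\ x = \sum_(i < n) f i.

Definition largest_semisimple_subring
    (R : comPzRingType) (S : subringClosed R) : Prop :=
  semisimple (subring_of S) /\
  forall T : subringClosed R, semisimple (subring_of T) -> {subset T <= S}.

Definition ring_isomorphic (R S : pzRingType) : Prop :=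
  exists f : {rmorphism R -> S}, bijective f.

Definition pradical (R : comNzRingType) (p : nat) : {pred R} :=
  fun x => `[< forall P : prime_idealr R, p%:R \in P -> x \in P >].
Arguments pradical : clear implicits.

Fact pradical_zmod_closed (R : comNzRingType) p : zmod_closed (pradical R p).
Proof.
split=> [|x y /asboolP hx /asboolP hy]; apply/asboolP => P pP; first exact: rpred0.
by rewrite rpredB ?hx ?hy.
Qed.
HB.instance Definition _ (R : comNzRingType) p :=
  GRing.isZmodClosed.Build R (pradical R p) (@pradical_zmod_closed R p).

Fact pradical_absorb (R : comNzRingType) p (a u : R) :
  u \in pradical R p -> a * u \in pradical R p.
Proof. by move=> /asboolP hu; apply/asboolP => P pP; apply/idealMr/hu. Qed.
HB.instance Definition _ (R : comNzRingType) p :=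
  isMulAbsorbing.Build R (pradical R p) (@pradical_absorb R p).

(* The p-radical of a subring, as a subset of the ambient ring.               *)
Definition Jp (R : comNzRingType) (p : nat) (A : subringClosed R) : {pred R} :=
  fun x => `[< exists2 y : subring_of A, y \in pradical _ p & val y = x >].

Definition zspan (V : zmodType) (S : {pred V}) : {pred V} :=
  fun x => `[< exists n (s : n.-tuple V), {subset s <= S} /\ inIntSpan s x >].

Definition is_full_lattice (K : fieldExtType rat) (L : {pred K}) : Prop :=
  (exists n (s : n.-tuple K), forall x, x \in L <-> inIntSpan s x) /\
  (exists2 b : seq K, basis_of {:K} b & {subset b <= L}).

Record fullLattice (K : fieldExtType rat) := FullLattice {
  lattice_pred :> {pred K};
  lattice_full : is_full_lattice lattice_pred
}.

(* Orders of K; [order] is taken by fingraph.                                 *)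
Record nfOrder (K : fieldExtType rat) := NfOrder {
  order_subring :> subringClosed K;
  order_full : is_full_lattice order_subring
}.

Lemma lattice_zmod_closed (K : fieldExtType rat) (I : fullLattice K) :
  zmod_closed I.
Proof.
have [[n [s hs]] _] := lattice_full I; split.
  apply/hs; exists [ffun=> 0]; rewrite big1 // => i _.
  by rewrite ffunE mulr0z.
move=> x y /hs[a ->] /hs[b ->]; apply/hs; exists [ffun i => a i - b i].
by rewrite -sumrB; apply: eq_bigr => i _; rewrite ffunE mulrzBr.
Qed.

Definition addset (V : zmodType) (A B : {pred V}) : {pred V} :=
  fun x => `[< exists a b, [/\ a \in A, b \in B & x = a + b] >].

Definition intmult (R : pzRingType) (m : int) : {pred R} :=
  fun x => `[< exists k : int, x = (m * k)%:~R >].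
Arguments intmult : clear implicits.

Definition lattice_mul (R : pzRingType) (I J : {pred R}) : {pred R} :=
  zspan (fun x => `[< exists i j, [/\ i \in I, j \in J & x = i * j] >]).

Definition ring_of_integers (K : fieldExtType rat) : {pred K} :=
  fun x => `[< integralOver (intr : int -> K) x >].
Arguments ring_of_integers : clear implicits.

Fact ring_of_integers_closed K : subring_closed (ring_of_integers K).
Proof.
split=> [|x y /asboolP hx /asboolP hy|x y /asboolP hx /asboolP hy]; apply/asboolP.
- exact: integral1.
- exact: integral_sub.
- exact: integral_mul.
Qed.
HB.instance Definition _ (K : fieldExtType rat) :=
  GRing.isSubringClosed.Build K (ring_of_integers K) (ring_of_integers_closed K).

Section Multiplicator.
Variables (K : fieldExtType rat) (I : fullLattice K).

Definition multiplicator : {pred K} :=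
  fun x => `[< forall y, y \in I -> x * y \in I >].

Fact multiplicator_closed : subring_closed multiplicator.
Proof.
have [_ IB] := lattice_zmod_closed I.
split=> [|x z /asboolP hx /asboolP hz|x z /asboolP hx /asboolP hz];
  apply/asboolP => y hy.
- by rewrite mul1r.
- by rewrite mulrBl IB ?hx ?hz.
- by rewrite -mulrA hx ?hz.
Qed.
HB.instance Definition _ :=
  GRing.isSubringClosed.Build K multiplicator multiplicator_closed.

(* I (to be precise, I :&: M(I)) as an ideal of M(I); when I^2 is contained   *)
(* in I, one has I \subset M(I).                                              *)
Definition lattice_ideal : {pred subring_of multiplicator} :=
  fun x => val x \in I.

Fact lattice_ideal_zmod_closed : zmod_closed lattice_ideal.
Proof.
have [I0 IB] := lattice_zmod_closed I.
by split=> [|x y hx hy]; rewrite unfold_in /lattice_ideal ?raddf0 // raddfB IB.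
Qed.
HB.instance Definition _ := GRing.isZmodClosed.Build
  (subring_of multiplicator) lattice_ideal lattice_ideal_zmod_closed.

Fact lattice_ideal_absorb (a u : subring_of multiplicator) :
  u \in lattice_ideal -> a * u \in lattice_ideal.
Proof.
rewrite !unfold_in /lattice_ideal rmorphM => hu.
by have /asboolP := valP a; apply.
Qed.
HB.instance Definition _ := isMulAbsorbing.Build
  (subring_of multiplicator) lattice_ideal lattice_ideal_absorb.

(* For I \subset A \subset M(I), the subring A/I of M(I)/I.                   *)
Definition subquot (A : subringClosed K) : {pred quot_ring lattice_ideal} :=
  fun y => `[< exists2 x : subring_of multiplicator,
                 val x \in A & y = \pi_(quot_ring lattice_ideal) x >].

Fact subquot_closed A : subring_closed (subquot A).
Proof.
split=> [|_ _ /asboolP[x hx ->] /asboolP[y hy ->]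
         |_ _ /asboolP[x hx ->] /asboolP[y hy ->]]; apply/asboolP.
- by exists 1 => //; rewrite rmorph1 rpred1.
- exists (x - y); first by rewrite raddfB rpredB.
  by symmetry; exact: (raddfB \pi_(Quotient.quot lattice_ideal)).
- exists (x * y); first by rewrite rmorphM rpredM.
  by symmetry; exact: quot_piM.
Qed.
HB.instance Definition _ A := GRing.isSubringClosed.Build
  (quot_ring lattice_ideal) (subquot A) (subquot_closed A).

Definition is_O_I (O : nfOrder K) : Prop :=
  [/\ {subset I <= O}, {subset O <= multiplicator}
    & largest_semisimple_subring (subquot O)].

End Multiplicator.

Arguments multiplicator {K} I.
Arguments lattice_ideal {K} I.
Arguments subquot {K} I A.

(* [le] is a preorder on T; joins and meets are taken up to the               *)
(* equivalence it induces, e.g. =i for inclusion of subsets.                  *)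
Definition forms_lattice (T : Type) (le : T -> T -> Prop) (C : T -> Prop) : Prop :=
  (exists x, C x) /\
  forall x y, C x -> C y ->
    (exists j, [/\ C j, le x j, le y j
                 & forall z, C z -> le x z -> le y z -> le j z]) /\
    (exists m, [/\ C m, le m x, le m y
                 & forall z, C z -> le z x -> le z y -> le z m]).

(* Main.v *)
Require Import Defs.
From HB Require Import structures.
From mathcomp Require Import all_boot all_order all_algebra all_field.
From mathcomp Require Import boolp classical_sets ring.

(* An element lies in the p-radical of a ring A iff one of its powers lies in *)
(* pA. If A consists of algebraic integers and x ^ n = p y with y integral,   *)
(* an integral equation of y shows that some power of x lies in pZ[x], so     *)
(* J_p(A) is the intersection of A with N = J_p(Z_K). The p-radical of an     *)
(* order between I and M(I) is thus I exactly when N meets it in I.           *)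
(*   In a finite commutative ring R of characteristic p, let S be the set of  *)
(* points that are periodic under Frobenius. A subring of R is semisimple iff *)
(* it is contained in S, S contains no nonzero nilpotent, and every x in R    *)
(* differs from some x ^ p ^ c in S by a nilpotent. Taking R = M(I)/I, the    *)
(* preimage of S is O_I, it meets N in I, and M(I)/J_p(M(I)) is isomorphic    *)
(* to S. If J_p(O) = I then O/I has no nonzero nilpotent, so O lies in O_I.   *)
(*   All subrings A with I <= A <= M(I) are orders, because pA <= I and the   *)
(* cosets of I in A are finitely many; joins and meets of orders with radical *)
(* I can therefore be formed by intersection.                                 *)

Set Implicit Arguments.
Unset Strict Implicit.
Unset Printing Implicit Defensive.

Import GRing.Theory.

Local Open Scope ring_scope.
Local Open Scope quotient_scope.

(** * Finite commutative rings of characteristic p *)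

(** Everything reduces to one intersection: with N = J_p(Z_K), [Jp_integral] gives J_p(O) = O ∩ N
    for every order O. It rests on [pradicalP] and [integral_power_dvd]. The inclusions are
    necessary because J_p(O) is an ideal of O that contains p and lies in N. Conversely, the
    inclusions make I an ideal of M(I) and M(I)/I a finite ring of characteristic p. There every
    element is periodic plus nilpotent ([frob_fixed_decomp]), only 0 is both ([frob_fixed_nilp]),
    and the periodic elements form the largest semisimple subring ([semisimple_sub_frob_fixed]).
    Since I lies in N, the nilpotents are the image of M(I) ∩ N (see [multiplicator_nilp]). So the
    preimage O_I of the periodic elements meets N in I ([Jp_O_I]), and an order O satisfies O ∩ N =
    I exactly when it lies between Z + I and O_I ([Jp_eq_iff]). The same splitting into periodic and
    nilpotent parts gives the isomorphism of (1). *)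

Section Frobenius.
Variables (R : comPzRingType) (p : nat).
Hypotheses (p_pr : prime p) (pR0 : p%:R = 0 :> R).

(** The inner binomial coefficients are divisible by p. The case of differences is additivity
    applied to [(x - y) + y], so the sign of (-1)^(p^k) never has to be discussed. *)
Lemma expp_sub k (x y : R) :
  (x - y) ^+ (p ^ k) = x ^+ (p ^ k) - y ^+ (p ^ k).
Proof.
suff expp_add (z t : R) : (z + t) ^+ (p ^ k) = z ^+ (p ^ k) + t ^+ (p ^ k).
  by have := expp_add (x - y) y; rewrite subrK => ->; rewrite addrK.
elim: k z t => [|k IHk] z t; first by rewrite !expr1.
rewrite expnSr !exprM IHk; set a := z ^+ _; set b := t ^+ _.
have [q def_p] : exists q, p = q.+2 by case: (p) p_pr => [|[|q]] // _; exists q.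
rewrite exprDn [in LHS]def_p big_ord_recl big_ord_recr /= -def_p.
rewrite big1 ?add0r => [|i _].
  by rewrite /bump /= add1n -def_p subn0 subnn expr0 mulr1 mul1r bin0 binn.
have /dvdnP[c ->] : (p %| 'C(p, bump 0 i))%N.
  by rewrite prime_dvd_bin //= /bump /= add1n def_p ltnS ltn_ord.
by rewrite mulrnA -mulr_natr pR0 mulr0.
Qed.

(** The exponent uses [k.+1] because p^0 = 1 would admit every element. *)
Definition frob_fixed : {pred R} := fun x => `[< exists k, x ^+ (p ^ k.+1) = x >].

Lemma frob_fixed_iter k m (x : R) : x ^+ (p ^ k) = x -> x ^+ (p ^ (k * m)) = x.
Proof.
move=> fix_x; elim: m => [|m IHm]; first by rewrite muln0 expr1.
by rewrite mulnS expnD exprM fix_x.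
Qed.

Lemma frob_fixed_subring_closed : subring_closed frob_fixed.
Proof.
split=> [|x y /asboolP[k kx] /asboolP[l ly]|x y /asboolP[k kx] /asboolP[l ly]];
  apply/asboolP.
- by exists 0%N; rewrite expr1n.
- exists (k.+1 * l.+1).-1; rewrite prednK // expp_sub.
  by rewrite (frob_fixed_iter _ kx) mulnC (frob_fixed_iter _ ly).
- exists (k.+1 * l.+1).-1; rewrite prednK // exprMn.
  by rewrite (frob_fixed_iter _ kx) mulnC (frob_fixed_iter _ ly).
Qed.

(** Going n times around the period gives x = x^(p^((k+1)n)), and that exponent is at least n. *)
Lemma frob_fixed_nilp (x : R) n : x \in frob_fixed -> x ^+ n = 0 -> x = 0.
Proof.
move=> /asboolP[k kx] xn0; have p_gt1 := prime_gt1 p_pr.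
rewrite -(frob_fixed_iter n kx) -(@subnK n (p ^ (k.+1 * n))).
  by rewrite exprD xn0 mulr0.
by rewrite (leq_trans (ltnW (ltn_expl n p_gt1))) // leq_exp2l // leq_pmull.
Qed.

(* x ^ p ^ c is a p-power-periodic point as soon as c is a multiple of the    *)
(* period of the sequence of x ^ p ^ i and at least the preperiod.            *)
Lemma frob_fixed_decomp (s : seq R) (x : R) : (forall y : R, y \in s) ->
  exists c, x ^+ (p ^ c.+1) \in frob_fixed /\
    exists n, (x - x ^+ (p ^ c.+1)) ^+ n = 0.
Proof.
move=> s_full; pose f i := x ^+ (p ^ i).
have /(uniqPn 0)[a [b [lt_ab lt_b]]] : ~~ uniq (map f (iota 0 (size s).+1)).
  apply/negP => /uniq_leq_size/(_ (fun y _ => s_full y)).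
  by rewrite size_map size_iota ltnn.
rewrite size_map size_iota in lt_b; have lt_a := ltn_trans lt_ab lt_b.
rewrite !(nth_map 0%N) ?size_iota // !nth_iota // !add0n => eq_ab.
pose d := (b - a)%N; have d_gt0 : (0 < d)%N by rewrite subn_gt0.
have per i m : (a <= i)%N -> f (i + d * m)%N = f i.
  move=> le_ai; elim: m => [|m IHm]; first by rewrite muln0 addn0.
  rewrite mulnS addnCA addnC -[RHS]IHm.
  have [j ->] : exists j, (i + d * m = a + j)%N.
    by exists (i + d * m - a)%N; rewrite subnKC // (leq_trans le_ai) // leq_addr.
  rewrite addnAC (subnKC (ltnW lt_ab)) /f !expnD !exprM.
  by rewrite -/(f a) -/(f b) eq_ab.
have c_gt0 : (0 < d * a.+1)%N by rewrite muln_gt0 d_gt0.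
have le_ac : (a <= d * a.+1)%N by rewrite (leq_trans (leqnSn a)) // leq_pmull.
exists (d * a.+1).-1; rewrite prednK //; have := per _ a.+1 le_ac.
rewrite /f expnD exprM => fix_fx; split.
  by apply/asboolP; exists (d * a.+1).-1; rewrite prednK.
(* With C = d(a+1), x and x^(p^C) have the same image under the C-th iterate of Frobenius, so that
   iterate kills their difference. *)
by exists (p ^ (d * a.+1))%N; rewrite expp_sub fix_fx subrr.
Qed.

End Frobenius.
Arguments frob_fixed : clear implicits.

Section PrincipalIdeal.
Variables (R : comPzRingType) (e : R).

Definition principal_ideal : {pred R} := fun x => `[< exists r, x = r * e >].

Fact principal_ideal_zmod_closed : zmod_closed principal_ideal.
Proof.
split=> [|_ _ /asboolP[r ->] /asboolP[s ->]]; apply/asboolP.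
  by exists 0; rewrite mul0r.
by exists (r - s); rewrite mulrBl.
Qed.
HB.instance Definition _ :=
  GRing.isZmodClosed.Build R principal_ideal principal_ideal_zmod_closed.

Fact principal_ideal_absorb a u :
  u \in principal_ideal -> a * u \in principal_ideal.
Proof. by move=> /asboolP[r ->]; apply/asboolP; exists (a * r); rewrite mulrA. Qed.
HB.instance Definition _ :=
  isMulAbsorbing.Build R principal_ideal principal_ideal_absorb.

End PrincipalIdeal.

(** Let y^2 = 0 and let f_i be the component of 1 in the simple ideal J_i. The ideal (y f_i) is 0 or
    J_i; in the second case f_i = r y f_i, so y f_i = r y^2 f_i = 0 again. Summing over i gives y =
    0. Other exponents reduce to squares, since n <= 2^n. *)
Lemma semisimple_reduced (R : comPzRingType) (x : R) n :
  semisimple R -> x ^+ n = 0 -> x = 0.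
Proof.
move=> [m [J [simpJ decR]]].
have sq0 (y : R) : y * y = 0 -> y = 0.
  move=> yy0; have [f [[fJ f1] _]] := decR 1.
  rewrite -[y]mulr1 f1 mulr_sumr big1 // => i _.
  have [_ /(_ (principal_ideal (y * f i)))[z|yf0|sJ]] := simpJ i.
  - by move=> /asboolP[r ->]; rewrite mulrA absorbM.
  - by apply: yf0; apply/asboolP; exists 1; rewrite mul1r.
  - have /asboolP[r ->] := sJ _ (fJ i).
    by rewrite mulrCA [y * (y * _)]mulrA yy0 mul0r mulr0.
move=> xn0; have: x ^+ (2 ^ n) = 0.
  by rewrite -(@subnK n (2 ^ n)) ?exprD ?xn0 ?mulr0 // ltnW // ltn_expl.
elim: n {xn0} => [|n IHn]; first by rewrite expr1.
by rewrite expnSr exprM expr2 => /sq0.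
Qed.

(* The simple summands are generated by the primitive idempotents.            *)
Lemma semisimple_periodic (R : comPzRingType) (s : seq R) :
    (forall x : R, x \in s) -> (forall x : R, exists n, x ^+ n.+2 = x) ->
  semisimple R.
Proof.
move=> s_full per.
have idem_pow (x : R) : x != 0 -> exists r, r * x != 0 /\ (r * x) * (r * x) = r * x.
  have [n xn] := per x; move=> x_neq0; exists (x ^+ n); rewrite -exprSr.
  split; last by rewrite -exprD addnS -addSn exprD xn -exprS.
  by apply: contraNneq x_neq0 => xn0; rewrite -xn exprSr xn0 mul0r.
pose prim (e : R) := [/\ e != 0, e * e = e &
  forall f, f * f = f -> f * e = f -> f = 0 \/ f = e].
pose P := undup [seq e <- s | `[< prim e >]].
have P_prim e : e \in P <-> prim e.
  by rewrite mem_undup mem_filter s_full andbT; split=> [/asboolP|/asboolP].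
have orth e f : prim e -> prim f -> e != f -> e * f = 0.
  move=> [_ ee mine] [_ ff minf] neq_ef.
  have efef : (e * f) * (e * f) = e * f by rewrite mulrACA ee ff.
  have [|//|efe] := mine (e * f) efef; first by rewrite mulrAC ee.
  have [|//|eff] := minf (e * f) efef; first by rewrite -mulrA ff.
  by case/eqP: neq_ef; rewrite -efe -{2}eff.
have prim_below u : u * u = u -> u != 0 -> exists e, prim e /\ e * u = e.
  (* Descent on the number of w with w v = w: replacing u by a smaller idempotent f yields no new w
     and loses u itself. *)
  pose below v := [seq w <- undup s | w * v == w].
  have [m] := ubnP (size (below u)); elim: m u => // m IHm u le_m uu u_neq0.
  have [[f [ff fu f_neq0 f_nequ]]|minu] :=
    pselect (exists f, [/\ f * f = f, f * u = f, f != 0 & f != u]); last first.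
    exists u; split=> //; split=> // f ff fu.
    have [->|f0] := eqVneq f 0; first by left.
    have [->|fu'] := eqVneq f u; first by right.
    by case: minu; exists f.
  have [|e [e_prim ef]] := IHm f _ ff f_neq0.
    rewrite -ltnS (leq_trans _ le_m) // ltnS /below.
    rewrite [X in (_ < X)%N](_ : _ = size (u :: rem u (below u))); last first.
      apply/perm_size/perm_to_rem.
      by rewrite mem_filter uu eqxx mem_undup s_full.
    rewrite ltnS; apply: uniq_leq_size; first by rewrite filter_uniq ?undup_uniq.
    move=> w; rewrite mem_filter => /andP[/eqP wf _].
    rewrite mem_rem_uniq ?filter_uniq ?undup_uniq // inE mem_filter.
    rewrite mem_undup s_full andbT -{2}wf -mulrA fu wf eqxx andbT.
    apply/eqP => wu; case/eqP: f_nequ.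
    by rewrite -fu mulrC -wu.
  by exists e; split=> //; rewrite -ef -mulrA fu.
have sumP : \sum_(e <- P) e = 1.
  (* The defect u is an idempotent orthogonal to all primitive ones. Were it nonzero, a primitive e
     below it would satisfy e = e u = 0. *)
  apply/eqP; rewrite eq_sym -subr_eq0; set u := 1 - _.
  have eu0 e : e \in P -> e * u = 0.
    move=> Pe; rewrite mulrBr mulr1 mulr_sumr (bigD1_seq e) ?undup_uniq //=.
    have /P_prim e_prim := Pe; have [_ -> _] := e_prim.
    rewrite big_seq_cond big1 ?addr0 ?subrr // => f /andP[/P_prim f_prim nfe].
    by rewrite orth // eq_sym.
  have uu : u * u = u.
    rewrite {1}/u mulrBl mul1r mulr_suml big_seq big1 ?subr0 // => e; exact: eu0.
  apply/negPn/negP => /(prim_below u uu)[e [e_prim eu]].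
  by have [/eqP[]] := e_prim; rewrite -eu eu0 //; apply/P_prim.
pose e (i : 'I_(size P)) := P`_i.
have Pe i : prim (e i) by apply/P_prim/mem_nth.
have e_orth i j : i != j -> e i * e j = 0.
  by move=> neq_ij; rewrite orth // nth_uniq ?undup_uniq.
exists (size P), (fun i => principal_ideal (e i) : ideal R); split=> [i|x].
  have [ei_neq0 ei_idem mini] := Pe i; split.
    by exists (e i) => //; apply/asboolP; exists 1; rewrite mul1r.
  move=> J sJe.
  have [[x xJ x_neq0]|J0] := pselect (exists2 x, x \in J & x != 0); last first.
    left=> x xJ; apply/eqP/negPn/negP => x_neq0; apply: J0.
    by exists x.
  (* A nonzero ideal inside (e_i) contains a nonzero idempotent; it lies below e_i, so primitivity
     makes it e_i. *)
  right; have [r [rx_neq0 rx_idem]] := idem_pow x x_neq0.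
  have rxJ : r * x \in J by rewrite absorbM.
  have /asboolP[t rxe] := sJe _ rxJ.
  have [|rx0|<-] := mini (r * x) rx_idem.
  - by rewrite rxe -mulrA ei_idem.
  - by rewrite rx0 eqxx in rx_neq0.
  - by move=> _ /asboolP[c ->]; rewrite absorbM.
exists [ffun i => x * e i]; split.
  split=> [i|]; first by rewrite ffunE; apply/asboolP; exists x.
  under eq_bigr do rewrite ffunE.
  by rewrite -mulr_sumr -[LHS]mulr1 -sumP (big_nth 0) big_mkord.
move=> f [fJ ->]; apply/ffunP => i; rewrite ffunE mulr_suml (bigD1 i) //=.
rewrite big1 ?addr0 => [|j neq_ji]; last first.
  by have /asboolP[r ->] := fJ j; rewrite -mulrA e_orth ?mulr0.
by have /asboolP[r ->] := fJ i; rewrite -mulrA; have [_ -> _] := Pe i.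
Qed.

(** A semisimple T is reduced, so the nilpotent x - x^(p^c) from [frob_fixed_decomp] vanishes for x
    in T. Conversely a finite ring of periodic elements satisfies [semisimple_periodic], because
    p^(k+1) >= 2. *)
Lemma semisimple_sub_frob_fixed (R : comPzRingType) (p : nat) (s : seq R)
    (T : subringClosed R) :
    prime p -> p%:R = 0 :> R -> (forall x : R, x \in s) ->
  semisimple (subring_of T) <-> {subset T <= frob_fixed R p}.
Proof.
move=> p_pr pR0 s_full; split=> [ssT x Tx|T_fixed].
  have [c [_ [n nil_x]]] := frob_fixed_decomp p_pr pR0 x s_full.
  pose y : subring_of T := SubringOf Tx.
  have /(semisimple_reduced ssT)/(congr1 val) : (y - y ^+ (p ^ c.+1)) ^+ n = 0.
    by apply: val_inj; rewrite rmorphXn rmorphB rmorphXn rmorph0.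
  rewrite rmorphB rmorphXn rmorph0 /= => /eqP; rewrite subr_eq0 => /eqP xE.
  by apply/asboolP; exists c.
apply: (@semisimple_periodic _ (pmap insub s)) => x; first by rewrite mem_pmap_sub.
have /asboolP[k kx] := T_fixed _ (valP x).
have [n def_n] : exists n, (p ^ k.+1)%N = n.+2.
  have: (1 < p ^ k.+1)%N by rewrite -{1}(expn0 p) ltn_exp2l ?prime_gt1.
  by case: (p ^ _)%N => [|[|n]] // _; exists n.
by exists n; apply: val_inj; rewrite rmorphXn -def_n.
Qed.

(** * Quotients and p-radicals *)

Section QuotRingPi.
Variables (R : comPzRingType) (J : ideal R).

Lemma quot_pi_eq0 (x : R) : \pi_(quot_ring J) x = 0 <-> x \in J.
Proof.
have <- : \pi_(quot_ring J) 0 = 0 by exact: (raddf0 \pi_(Quotient.quot J)).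
by split=> [/quot_piP|xJ]; [|apply/quot_piP]; rewrite subr0.
Qed.

Lemma quot_piB (x y : R) :
  \pi_(quot_ring J) (x - y) = \pi_(quot_ring J) x - \pi_(quot_ring J) y.
Proof. exact: (raddfB \pi_(Quotient.quot J)). Qed.

Lemma quot_piX n (x : R) : \pi_(quot_ring J) (x ^+ n) = (\pi_(quot_ring J) x) ^+ n.
Proof. by elim: n => // n IHn; rewrite !exprS -IHn; exact: quot_piM. Qed.

Lemma quot_pi_nat n : \pi_(quot_ring J) n%:R = n%:R.
Proof.
elim: n => [|n IHn]; first by apply/quot_pi_eq0; rewrite rpred0.
by rewrite !mulrS -IHn -quot_piD.
Qed.

End QuotRingPi.

(** The last two hypotheses say that T is a complement of J'/J in R/J, so the composite T -> R/J ->
    R/J' is bijective. That composite is [g], computed on representatives; the isomorphism sought is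
    its inverse. *)
Lemma quot_ring_isomorphic (R : comPzRingType) (J J' : ideal R)
    (T : subringClosed (quot_ring J)) :
    {subset J <= J'} ->
    (forall x, \pi_(quot_ring J) x \in T -> x \in J' -> x \in J) ->
    (forall x, exists y, \pi_(quot_ring J) y \in T /\ x - y \in J') ->
  ring_isomorphic (quot_ring J') (subring_of T).
Proof.
move=> sJJ' injT surjT.
pose g (s : subring_of T) : quot_ring J' := \pi_(quot_ring J') (repr (val s)).
have gE (s : subring_of T) x : val s = \pi_(quot_ring J) x -> g s = \pi_(quot_ring J') x.
  by move=> sx; apply/quot_piP/sJJ'/quot_piP; rewrite reprK.
have valE (s : subring_of T) : val s = \pi_(quot_ring J) (repr (val s)) by rewrite reprK.
have gB : zmod_morphism g.
  move=> s t; rewrite (gE _ (repr (val s) - repr (val t))).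
    exact: (raddfB \pi_(Quotient.quot J')).
  rewrite raddfB /= {1}(valE s) {1}(valE t); symmetry.
  exact: (raddfB \pi_(Quotient.quot J)).
have gM : monoid_morphism g.
  split; first exact: gE.
  move=> s t; rewrite (gE _ (repr (val s) * repr (val t))); first exact: quot_piM.
  by rewrite rmorphM /= {1}(valE s) {1}(valE t) quot_piM.
pose gR : {rmorphism subring_of T -> quot_ring J'} := HB.pack g
  (GRing.isZmodMorphism.Build _ _ g gB) (GRing.isMonoidMorphism.Build _ _ g gM).
have inj_g : injective gR.
  move=> s t gst; apply/val_inj; rewrite (valE s) (valE t).
  apply/quot_piP/injT; last exact/quot_piP.
  have := rpredB (valP s) (valP t); rewrite {1}(valE s) {1}(valE t).
  by rewrite -(raddfB \pi_(Quotient.quot J)).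
have surj_g q : exists s, gR s = q.
  have [y [Ty xy]] := surjT (repr q).
  exists (SubringOf Ty); rewrite [LHS](gE _ y) // -[RHS]reprK.
  by apply/quot_piP; rewrite -opprB rpredN.
pose f q := projT1 (cid (surj_g q)).
have gf q : gR (f q) = q by rewrite /f; case: cid.
have fg : cancel gR f by move=> s; apply: inj_g; rewrite gf.
pose fR : {rmorphism quot_ring J' -> subring_of T} := HB.pack f
  (GRing.isZmodMorphism.Build _ _ f (can2_zmod_morphism fg gf))
  (GRing.isMonoidMorphism.Build _ _ f (can2_monoid_morphism fg gf)).
by exists fR; exists gR.
Qed.

(** An ideal maximal among those containing c and no power of x is prime: for u, v outside it, both
    enlarged ideals contain powers of x, and the product of these powers would lie in the ideal if u
    v did. *)
Lemma prime_avoiding_powers (R : comNzRingType) (c x : R) :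
    (forall n y, x ^+ n <> c * y) ->
  exists P : prime_idealr R, c \in P /\ x \notin P.
Proof.
move=> x_nilp.
pose good (A : set R) := [/\ A c, forall y z, A y -> A z -> A (y - z),
  forall a y, A y -> A (a * y) & forall n, ~ A (x ^+ n)].
have [|A [[A0|[Ac AB AM Ax]] maxA]] := @Zorn_bigcup R (fun A => A = set0 \/ good A).
- move=> F F_good F_tot.
  have [[A [FA [y Ay]]]|F0] := pselect (exists A, F A /\ exists y, A y).
    have goodF B z : F B -> B z -> good B.
      by move=> /F_good[-> //|].
    right; split.
    + by exists A => //; case: (goodF A y FA Ay).
    + move=> u v [B FB Bu] [C FC Cv].
      have [sBC|sCB] := F_tot B C FB FC.
        by exists C => //; case: (goodF C v FC Cv) => _ + _ _; apply=> //; apply: sBC.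
      by exists B => //; case: (goodF B u FB Bu) => _ + _ _; apply=> //; apply: sCB.
    + by move=> a u [B FB Bu]; exists B => //; case: (goodF B u FB Bu) => _ _ + _; apply.
    + by move=> n [B FB Bx]; case: (goodF B _ FB Bx) => _ _ _ /(_ n).
  left; apply/seteqP; split=> // y [B FB By]; case: F0.
  by exists B; split=> //; exists y.
- exfalso; case: (maxA [set y | exists r, y = c * r]%classic).
    by rewrite A0; split=> [y []|/(_ 0) /=]; apply; exists 0; rewrite mulr0.
  right; split=> [|_ _ [r ->] [s ->]|a _ [r ->]|n [r]] /=.
  + by exists 1; rewrite mulr1.
  + by exists (r - s); rewrite mulrBr.
  + by exists (a * r); rewrite mulrCA.
  + exact: x_nilp.
have AD y z : A y -> A z -> A (y + z).
  by move=> Ay Az; rewrite -[z]opprK; apply: (AB) => //; rewrite -mulN1r; apply: AM.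
have meets u : ~ A u -> exists n y r, A y /\ x ^+ n = y + r * u.
  move=> Au; apply: contrapT => no_pow.
  case: (maxA [set z | exists y r, A y /\ z = y + r * u]%classic).
    split=> [y Ay|/(_ u)]; first by exists y, 0; rewrite mul0r addr0.
    move=> sA; apply/Au/sA; exists 0, 1; rewrite mul1r add0r; split=> //.
    by rewrite -(subrr c); apply: AB.
  right; split.
  - by exists c, 0; rewrite mul0r addr0.
  - move=> _ _ [y [r [Ay ->]]] [z [s [Az ->]]]; exists (y - z), (r - s).
    by split; [apply: AB | rewrite mulrBl addrACA opprD].
  - move=> a _ [y [r [Ay ->]]]; exists (a * y), (a * r).
    by split; [apply: AM | rewrite mulrDr mulrA].
  - by move=> n [y [r [Ay xn]]]; apply: no_pow; exists n, y, r.
pose S : {pred R} := fun y => `[< A y >].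
have zS : zmod_closed S.
  split=> [|y z /asboolP Ay /asboolP Az]; apply/asboolP; last exact: AB.
  by rewrite -(subrr c); apply: AB.
have pS : 1 \notin S /\ forall a, {in S, forall u, a * u \in S}.
  split; first by apply/asboolPn; rewrite -(expr0 x).
  by move=> a y /asboolP Ay; apply/asboolP/AM.
have primeS : prime_idealr_closed S.
  move=> u v /asboolP Auv; apply/orP; rewrite -!(rwP (asboolP _)).
  apply: contrapT => /not_orP[/meets[n [y [r [Ay xn]]]] /meets[m [z [t [Az xm]]]]].
  apply: (Ax (n + m)%N); rewrite exprD xn xm.
  have -> : (y + r * u) * (z + t * v) = (z + t * v) * y + r * u * z + r * t * (u * v).
    by ring.
  by apply: (AD); [apply: AD|]; apply: AM.
pose P : prime_idealr R := HB.pack S (GRing.isZmodClosed.Build R S zS)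
  (isProperIdeal.Build R S pS) (isPrimeIdealrClosed.Build R S primeS).
exists P; split; first exact/asboolP.
by apply/asboolPn; rewrite -[x]expr1.
Qed.

(** This replaces the primes of each ring by an equation, which can be compared between subrings of
    K. The hard direction is [prime_avoiding_powers] with c = p. *)
Lemma pradicalP (R : comNzRingType) p (x : R) :
  x \in pradical R p <-> exists n y, x ^+ n = p%:R * y.
Proof.
split=> [/asboolP radx|[n [y xn]]]; last first.
  apply/asboolP => P pP; have: x ^+ n \in P by rewrite xn mulrC idealMr.
  elim: n {xn} => [|n IHn]; first by rewrite expr0 idealr1.
  by rewrite exprS prime_idealrM => /orP[].
apply: contrapT => no_pow; have [n y xn|P [pP /negP]] := @prime_avoiding_powers R p%:R x.
  by apply: no_pow; exists n, y.
by case; apply: radx.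
Qed.

Lemma mem_pradical (R : comNzRingType) p (A : subringClosed R) (x : subring_of A) :
  val x \in Jp p A <-> x \in pradical (subring_of A) p.
Proof.
split=> [/asboolP[y radx /val_inj <-] //|radx].
by apply/asboolP; exists x.
Qed.

Lemma JpP (R : comNzRingType) p (A : subringClosed R) x :
  x \in Jp p A <-> x \in A /\ exists n y, y \in A /\ x ^+ n = p%:R * y.
Proof.
split=> [/asboolP[y /pradicalP[n [z yn]] <-]|[Ax [n [y [Ay xn]]]]].
  split; first exact: valP.
  by exists n, (val z); split; [exact: valP | rewrite -rmorphXn yn rmorphM rmorph_nat].
rewrite -[x]/(val (SubringOf Ax)); apply/mem_pradical/pradicalP.
exists n, (SubringOf Ay); apply: val_inj.
by rewrite rmorphXn rmorphM rmorph_nat.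
Qed.

Lemma Jp_sub (R : comNzRingType) p (A : subringClosed R) x : x \in Jp p A -> x \in A.
Proof. by case/JpP. Qed.

Lemma Jp_root (R : comNzRingType) p (A : subringClosed R) x n :
  x \in A -> x ^+ n \in Jp p A -> x \in Jp p A.
Proof.
move=> Ax /JpP[_ [m [y [Ay xnm]]]]; apply/JpP; split=> //.
by exists (n * m)%N, y; rewrite exprM.
Qed.

Lemma Jp_absorb (R : comNzRingType) p (A : subringClosed R) x y :
  x \in A -> y \in Jp p A -> x * y \in Jp p A.
Proof.
move=> Ax /JpP[Ay [n [z [Az yn]]]]; apply/JpP; split; first exact: rpredM.
exists n, (x ^+ n * z); split; first by rewrite rpredM ?rpredX.
by rewrite exprMn yn mulrCA.
Qed.

Lemma Jp_char (R : comNzRingType) p (A : subringClosed R) : p%:R \in Jp p A.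
Proof.
apply/JpP; split; first exact: rpred_nat.
by exists 1%N, 1; rewrite mulr1 expr1 rpred1.
Qed.

(** * Lattices and integrality *)

Lemma subring_of_pred (R : pzRingType) (S : {pred R}) :
  subring_closed S -> exists A : subringClosed R, A =i S.
Proof.
move=> closS.
by exists (HB.pack S (GRing.isSubringClosed.Build R S closS) : subringClosed R).
Qed.

Lemma mem_intSpan (V : zmodType) n (s : n.-tuple V) x : x \in s -> inIntSpan s x.
Proof.
move=> /tnthP[i ->]; exists [ffun j => (j == i)%:Z].
rewrite (bigD1 i) //= ffunE eqxx mulr1z (tnth_nth 0) big1 ?addr0 // => j ne_ji.
by rewrite ffunE (negbTE ne_ji) mulr0z.
Qed.

Lemma intSpan_sub (V : zmodType) n (s : n.-tuple V) x y :
  inIntSpan s x -> inIntSpan s y -> inIntSpan s (x - y).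
Proof.
move=> [a ->] [b ->]; exists [ffun i => a i - b i].
by rewrite -sumrB; apply: eq_bigr => i _; rewrite ffunE mulrzBr.
Qed.

Lemma intSpan_min (V : zmodType) (A : {pred V}) n (s : n.-tuple V) x :
  zmod_closed A -> {subset s <= A} -> inIntSpan s x -> x \in A.
Proof.
move=> zA sA [a ->].
pose A' : zmodClosed V := HB.pack A (GRing.isZmodClosed.Build V A zA).
rewrite -[A]/(A' : {pred V}); apply: rpred_sum => i _; apply: rpredMz.
by apply: sA; rewrite mem_nth ?size_tuple.
Qed.

(** Finite choice: one witness is kept for each inhabited class. It is applied below to classes
    indexed by vectors of residues modulo p. *)
Lemma finite_representatives (F : finType) (T : eqType) (Rel : F -> T -> Prop) :
  exists t : seq T, (forall y, y \in t -> exists f, Rel f y) /\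
    forall f x, Rel f x -> exists2 y, y \in t & Rel f y.
Proof.
suff [t [tR Rt]] : exists t : seq T, (forall y, y \in t -> exists f, Rel f y) /\
    forall f, f \in enum F -> forall x, Rel f x -> exists2 y, y \in t & Rel f y.
  by exists t; split=> // f x; apply: Rt; rewrite mem_enum.
elim: (enum F) => [|f l [t [tR Rt]]]; first by exists [::].
have [[x Rfx]|noR] := pselect (exists x, Rel f x).
  exists (x :: t); split=> [y /predU1P[->|/tR //]|g]; first by exists f.
  rewrite inE => /predU1P[->|lg] z Rz; first by exists x => //; rewrite mem_head.
  by have [y ty Ry] := Rt g lg z Rz; exists y => //; rewrite inE ty orbT.
exists t; split=> // g /predU1P[->|/Rt //] z Rz.
by case: noR; exists z.
Qed.

Section Lattices.
Variables (K : fieldExtType rat) (I : fullLattice K) (p : nat).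
Hypothesis p_gt0 : (0 < p)%N.

Let pK_neq0 : p%:R != 0 :> K.
Proof. by rewrite -(rmorph_nat (in_alg K)) fmorph_eq0 Num.Theory.pnatr_eq0 -lt0n. Qed.

(** Write p x in the generators of I and reduce the coefficients modulo p. If x and y give the same
    residues, then p(x - y) lies in pI, so x - y lies in I. *)
Lemma finite_cosets (A : {pred K}) : (forall x, x \in A -> p%:R * x \in I) ->
  exists t : seq K, {subset t <= A} /\
    forall x, x \in A -> exists2 y, y \in t & x - y \in I.
Proof.
move=> pAI; have [[n [s Is]] _] := lattice_full I.
have [I0 IB] := lattice_zmod_closed I.
pose Rel (f : {ffun 'I_n -> 'I_p}) x := x \in A /\
  exists2 z, z \in I & p%:R * x = \sum_(i < n) s`_i *~ (f i)%:Z + p%:R * z.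
have [t [tR Rt]] := finite_representatives Rel.
exists t; split=> [y /tR[f []] //|x Ax]; have /Is[a pxE] := pAI x Ax.
have lt_ap i : (`|(a i %% p)%Z| < p)%N.
  by rewrite -ltz_nat gez0_abs ?modz_ge0 ?ltz_pmod // eqz_nat -lt0n.
pose f := [ffun i => Ordinal (lt_ap i)].
pose z := \sum_(i < n) s`_i *~ (a i %/ p)%Z.
have Iz : z \in I.
  by apply/Is; exists [ffun i => (a i %/ p)%Z]; apply: eq_bigr => i _; rewrite ffunE.
have {}pxE : p%:R * x = \sum_(i < n) s`_i *~ (f i)%:Z + p%:R * z.
  rewrite pxE mulr_sumr -big_split; apply: eq_bigr => i _ /=.
  rewrite ffunE /= gez0_abs ?modz_ge0 ?eqz_nat -?lt0n //.
  rewrite {1}(divz_eq (a i) p) mulrzDr addrC; congr (_ + _).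
  by rewrite mulr_natl mulrzA pmulrn.
have [|y ty [Ay [z' Iz' pyE]]] := Rt f x; first by split=> //; exists z.
exists y => //; rewrite (_ : x - y = z - z') ?IB //.
by apply: (mulfI pK_neq0); rewrite !mulrBr pxE pyE opprD addrACA subrr add0r.
Qed.

(** Generators of I together with representatives of the finitely many cosets generate A, and A
    inherits a rational basis from I. *)
Lemma full_lattice_above (A : {pred K}) : zmod_closed A -> {subset I <= A} ->
  (forall x, x \in A -> p%:R * x \in I) -> is_full_lattice A.
Proof.
move=> zA sIA pAI; have [[n [s Is]] [b b_basis sbI]] := lattice_full I.
split; last by exists b => // x /sbI/sIA.
have [t [tA At]] := finite_cosets pAI.
exists (n + size t)%N, (cat_tuple s (in_tuple t)) => x; split=> [Ax|].
  have [y ty xyI] := At x Ax; rewrite -(subrK y x) -[y in _ + y]opprK.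
  have span0 : inIntSpan (cat_tuple s (in_tuple t)) 0.
    by exists [ffun=> 0]; rewrite big1 // => i _; rewrite ffunE mulr0z.
  apply: intSpan_sub; last first.
    rewrite -sub0r; apply: intSpan_sub => //.
    by apply/mem_intSpan; rewrite mem_cat ty orbT.
  have /Is sxy := xyI; apply/asboolP.
  apply: (intSpan_min (A := fun x => `[< inIntSpan _ x >])) sxy => [|z sz].
    split=> [|u v /asboolP su /asboolP sv]; apply/asboolP => //.
    exact: intSpan_sub.
  by apply/asboolP/mem_intSpan; rewrite mem_cat sz.
apply: intSpan_min zA _ => y; rewrite mem_cat => /orP[sy|/tA //].
by apply/sIA/Is/mem_intSpan.
Qed.

End Lattices.

(** Multiplication by x on the generators is given by an integer matrix. The row of generators is an
    eigenvector for x, nonzero because the generators span 1, so x is a root of a monic integral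
    characteristic polynomial. *)
Lemma lattice_ring_integral (K : fieldExtType rat) (A : subringClosed K) :
    (exists n (s : n.-tuple K), forall x, x \in A <-> inIntSpan s x) ->
  {subset A <= ring_of_integers K}.
Proof.
move=> [n [s As]] x Ax; apply/asboolP.
have /choice[a aE] (i : 'I_n) : exists a : {ffun 'I_n -> int},
    x * s`_i = \sum_(j < n) s`_j *~ a j.
  apply/As; rewrite rpredM //; apply/As/mem_intSpan.
  by rewrite mem_nth ?size_tuple.
pose M : 'M[int]_n := \matrix_(j, i) a i j.
pose v : 'rV[K]_n := \row_j s`_j.
exists (char_poly M); first exact: char_poly_monic.
rewrite map_char_poly -eigenvalue_root_char; apply/eigenvalueP; exists v.
  apply/rowP => i; rewrite !mxE aE; apply: eq_bigr => j _.
  by rewrite !mxE mulrzr.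
apply/eqP => v0; have /As[c] := rpred1 A; rewrite big1 => [/eqP|i _].
  by rewrite oner_eq0.
by move/rowP: v0 => /(_ i); rewrite !mxE => ->; rewrite mul0rz.
Qed.

(* Scaling an integral equation of y of degree d by c ^ d turns the equation  *)
(* for y into c-divisibility of (x ^ n) ^ d inside Z[x].                      *)
Lemma integral_power_dvd (K : fieldExtType rat) (A : subringClosed K)
    (c : int) (x y : K) n :
    x \in A -> y \in ring_of_integers K -> x ^+ n = c%:~R * y ->
  exists m z, z \in A /\ x ^+ m = c%:~R * z.
Proof.
move=> Ax /asboolP[q q_monic /rootP qy0] xn.
pose d := (size q).-1; set w := x ^+ n in xn.
have size_q : size q = d.+1.
  by rewrite /d prednK // lt0n size_poly_eq0 monic_neq0.
(* With w = c y, multiplying the equation of y by c^d gives w^d = - sum of q_i c^(d-i) w^i over i <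
   d; [z] is the right-hand side with one factor c removed. *)
pose z := - \sum_(i < d) (q`_i * c ^+ (d - i.+1))%:~R * w ^+ i.
exists (n * d)%N, z; split.
  by rewrite rpredN rpred_sum // => i _; rewrite rpredM ?rpred_int ?rpredX.
rewrite exprM -/w; apply/eqP; rewrite mulrN -addr_eq0; apply/eqP.
transitivity (c%:~R ^+ d * (map_poly (intr : int -> K) q).[y]); last first.
  by rewrite qy0 mulr0.
rewrite (horner_coef_wide _ (size_poly _ _)) size_q big_ord_recr /= addrC.
rewrite mulrDr !mulr_sumr; congr (_ + _).
  rewrite coef_poly ltnSn -[d]/(size q).-1 -lead_coefE (monicP q_monic) mul1r.
  by rewrite xn exprMn.
apply: eq_bigr => i _; rewrite coef_poly ltnS ltnW // rmorphM rmorphXn /= xn exprMn.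
have -> : c%:~R ^+ d = c%:~R * c%:~R ^+ i * c%:~R ^+ (d - i.+1) :> K.
  by rewrite -exprS -exprD subnKC.
ring.
Qed.

Section Radicals.
Variables (K : fieldExtType rat) (p : nat).
Local Notation N := (Jp p (ring_of_integers K)).

(** From A to Z_K the cofactor y of p stays integral. In the other direction y is only known to be
    integral, and [integral_power_dvd] moves the cofactor into A at the cost of a higher power of
    x. *)
Lemma Jp_integral (A : subringClosed K) : {subset A <= ring_of_integers K} ->
  forall x, x \in Jp p A <-> x \in A /\ x \in N.
Proof.
move=> sAZ x; split=> [/JpP[Ax [n [y [Ay xn]]]]|[Ax /JpP[_ [n [y [Zy xn]]]]]].
  split=> //; apply/JpP; split; first exact: sAZ.
  by exists n, y; split=> //; apply: sAZ.
by apply/JpP; split=> //; exact: (@integral_power_dvd K A p x y n).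
Qed.

End Radicals.
Arguments Jp_integral {K p A}.

(** * Orders with a given p-radical *)

Section RadicalLattice.
Variables (K : fieldExtType rat) (p : nat) (I : fullLattice K).
Hypotheses (p_pr : prime p) (pI : p%:R \in I).
Hypothesis mulI : forall x y, x \in I -> y \in I -> x * y \in I.
Hypothesis sIN : {subset I <= Jp p (ring_of_integers K)}.

Local Notation M := (multiplicator I).
Local Notation Q := (quot_ring (lattice_ideal I)).

Lemma lattice_addr x y : x \in I -> y \in I -> x + y \in I.
Proof. exact: (Algebra.zmod_closed0D (lattice_zmod_closed I)).2. Qed.

Lemma lattice_sub_multiplicator : {subset I <= M}.
Proof. by move=> x Ix; apply/asboolP => y; apply: mulI. Qed.

Lemma multiplicator_absorb x y : x \in M -> y \in I -> x * y \in I.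
Proof. by move=> /asboolP; apply. Qed.

Lemma char_multiplicator x : x \in M -> p%:R * x \in I.
Proof. by move=> Mx; rewrite mulrC multiplicator_absorb. Qed.

Lemma between_full_lattice (A : subringClosed K) :
  {subset I <= A} -> {subset A <= M} -> is_full_lattice A.
Proof.
move=> sIA sAM; apply: (full_lattice_above (prime_gt0 p_pr)) sIA _.
  by split=> [|x y Ax Ay]; [exact: rpred0 | exact: rpredB].
by move=> x /sAM/char_multiplicator.
Qed.

Lemma multiplicator_integral : {subset M <= ring_of_integers K}.
Proof.
apply: lattice_ring_integral.
by have [] := between_full_lattice lattice_sub_multiplicator (fun x Mx => Mx).
Qed.

Lemma char_quot : p%:R = 0 :> Q.
Proof.
rewrite -quot_pi_nat; apply/quot_pi_eq0.
by rewrite unfold_in /lattice_ideal rmorph_nat.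
Qed.

Lemma finite_quot : exists s : seq Q, forall y, y \in s.
Proof.
have [t [tM Mt]] := finite_cosets (prime_gt0 p_pr) char_multiplicator.
(* The default 0 is never taken, since all representatives lie in M(I). *)
exists [seq \pi_Q (insubd 0 y) | y <- t] => r; rewrite -[r]reprK.
have [y ty xyI] := Mt _ (valP (repr r)).
apply/mapP; exists y => //; apply/quot_piP.
by rewrite unfold_in /lattice_ideal rmorphB /= insubdK // tM.
Qed.

(** The preimage in M(I) of the periodic elements contains I because 0 is periodic; lying between I
    and M(I), it is a full lattice. *)
Lemma exists_frob_fixed_order : exists O : nfOrder K,
  [/\ {subset I <= O}, {subset O <= M} & forall x : subring_of M,
      val x \in O <-> \pi_Q x \in frob_fixed Q p].
Proof.
have [S1 SB SM] := frob_fixed_subring_closed p_pr char_quot.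
have [A defA] : exists A : subringClosed K, A =i (fun x =>
    `[< exists2 y : subring_of M, val y = x & \pi_Q y \in frob_fixed Q p >]).
  apply: subring_of_pred; split=> [|_ _ /asboolP[x <- Sx] /asboolP[y <- Sy]
    |_ _ /asboolP[x <- Sx] /asboolP[y <- Sy]]; apply/asboolP.
  - by exists 1; [rewrite rmorph1 | exact: S1].
  - by exists (x - y); [rewrite rmorphB | rewrite quot_piB SB].
  - exists (x * y); [by rewrite rmorphM|].
    have -> : \pi_Q (x * y) = \pi_Q x * \pi_Q y by exact: quot_piM.
    exact: SM.
have memA (x : subring_of M) : val x \in A <-> \pi_Q x \in frob_fixed Q p.
  rewrite defA; split=> [/asboolP[y /val_inj <-] //|Sx].
  by apply/asboolP; exists x.
have sAM : {subset A <= M}.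
  by move=> x; rewrite defA => /asboolP[y <- _]; exact: valP.
have sIA : {subset I <= A}.
  move=> x Ix; have Mx := lattice_sub_multiplicator Ix.
  rewrite -[x]/(val (SubringOf Mx)); apply/memA.
  suff -> : \pi_Q (SubringOf Mx) = 0 by rewrite -(subrr 1) SB.
  exact/quot_pi_eq0.
by exists (NfOrder (between_full_lattice sIA sAM)).
Qed.

Variable O_I : nfOrder K.
Hypotheses (sIO : {subset I <= O_I}) (sOM : {subset O_I <= M}).
Hypothesis OIP : forall x : subring_of M,
  val x \in O_I <-> \pi_Q x \in frob_fixed Q p.

Lemma mem_subquot (A : subringClosed K) (x : subring_of M) :
  {subset I <= A} -> \pi_Q x \in subquot I A <-> val x \in A.
Proof.
move=> sIA; split=> [/asboolP[y Ay /quot_piP xy]|Ax]; last first.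
  by apply/asboolP; exists x.
rewrite -(subrK y x) rmorphD rpredD // sIA //.
Qed.

Lemma subquot_frob_fixed r : r \in subquot I O_I <-> r \in frob_fixed Q p.
Proof. by rewrite -[r]reprK mem_subquot. Qed.

Lemma frob_fixed_is_O_I : is_O_I I O_I.
Proof.
have [s s_full] := finite_quot.
have ssP := semisimple_sub_frob_fixed _ p_pr char_quot s_full.
split=> //; split; first by apply/ssP => r /subquot_frob_fixed.
by move=> T /ssP sT r /sT /subquot_frob_fixed.
Qed.

(** A largest semisimple subring is unique, and an order between I and M(I) is recovered from its
    image in M(I)/I. *)
Lemma is_O_I_unique (O : nfOrder K) : is_O_I I O -> O =i O_I.
Proof.
move=> [sIO' sOM' [ssO maxO]]; have [_ _ [ssOI maxOI]] := frob_fixed_is_O_I.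
have sub (A B : nfOrder K) : {subset I <= A} -> {subset I <= B} ->
    {subset A <= M} -> {subset subquot I A <= subquot I B} -> {subset A <= B}.
  move=> sIA sIB sAM sAB x Ax; rewrite -[x]/(val (SubringOf (sAM x Ax))).
  by apply/mem_subquot/sAB/mem_subquot.
by move=> x; apply/idP/idP; apply: sub => //; [apply: maxOI | apply: maxO].
Qed.

(** A power of x lies in I, hence in N. As N is closed under integral roots, x lies in M(I) ∩ N. *)
Lemma multiplicator_nilp (x : subring_of M) n :
  \pi_Q x ^+ n = 0 -> val x \in Jp p M.
Proof.
rewrite -quot_piX => /quot_pi_eq0 xnI.
have xnN : val x ^+ n \in Jp p (ring_of_integers K).
  by rewrite -rmorphXn sIN.
apply/(Jp_integral multiplicator_integral); split; first exact: valP.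
by apply: Jp_root xnN; apply/multiplicator_integral/valP.
Qed.

Lemma O_I_integral : {subset O_I <= ring_of_integers K}.
Proof. by move=> x /sOM/multiplicator_integral. Qed.

(** If x^n = p y with y in O_I, then x^n lies in I, so the class of x is both nilpotent and
    periodic, hence zero. *)
Lemma Jp_O_I : Jp p O_I =i I.
Proof.
move=> x; apply/idP/idP => [/JpP[Ox [n [y [Oy xn]]]]|Ix]; last first.
  by apply/(Jp_integral O_I_integral); split; [apply: sIO | apply: sIN].
have /quot_pi_eq0 : \pi_Q (SubringOf (sOM Ox)) = 0.
  apply: (frob_fixed_nilp (n := n) p_pr); first exact/OIP.
  rewrite -quot_piX; apply/quot_pi_eq0.
  by rewrite unfold_in /lattice_ideal rmorphXn /= xn char_multiplicator // sOM.
by rewrite unfold_in.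
Qed.

(** If O lies between the bounds, then I is contained in O ∩ N, which is contained in O_I ∩ N = I.
    If J_p(O) = I, then I is an ideal of O, so O lies in M(I). For x in O some x - x^(p^C) is
    nilpotent modulo I, hence lies in O ∩ N = I; so x is periodic modulo I. *)
Lemma Jp_eq_iff (O : nfOrder K) : Jp p O =i I <->
  {subset addset (intmult K 1) I <= O} /\ {subset O <= O_I}.
Proof.
have [O_lat _] := order_full O; have sOZ := lattice_ring_integral O_lat.
split=> [JpO|[sZIO sOO]]; last first.
  have sIO' : {subset I <= O}.
    move=> x Ix; apply: sZIO; apply/asboolP; exists 0, x; split=> //.
      by apply/asboolP; exists 0; rewrite mulr0.
    by rewrite add0r.
  move=> x; apply/idP/idP => [/(Jp_integral sOZ)[Ox Nx]|Ix].
    by rewrite -Jp_O_I; apply/(Jp_integral O_I_integral); split=> //; apply: sOO.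
  by apply/(Jp_integral sOZ); split; [apply: sIO' | apply: sIN].
have sIO' : {subset I <= O} by move=> x; rewrite -JpO => /Jp_sub.
split=> [_ /asboolP[a [x [/asboolP[k ->] Ix ->]]]|x Ox].
  by rewrite rpredD ?rpred_int // sIO'.
have Mx : x \in M by apply/asboolP => y; rewrite -!JpO; apply: Jp_absorb.
have [s s_full] := finite_quot.
have [c [_ [n]]] := frob_fixed_decomp p_pr char_quot (\pi_Q (SubringOf Mx)) s_full.
rewrite -quot_piX -quot_piB => /multiplicator_nilp.
rewrite rmorphB rmorphXn /= => /(Jp_integral multiplicator_integral)[_ Nz].
rewrite -[x]/(val (SubringOf Mx)); apply/OIP/asboolP; exists c.
rewrite -quot_piX; symmetry; apply/quot_piP.
rewrite unfold_in /lattice_ideal rmorphB rmorphXn /= -JpO.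
by apply/(Jp_integral sOZ); split; rewrite ?rpredB ?rpredX.
Qed.

(** Modulo I, the periodic elements form a complement of the nilpotent image of J_p(M(I)): only 0 is
    both, and every element is a sum of the two kinds. *)
Lemma multiplicator_pradical_quotient :
  ring_isomorphic (quot_ring (pradical (subring_of M) p)) (subring_of (subquot I O_I)).
Proof.
have sub_rad x : x \in lattice_ideal I -> x \in pradical (subring_of M) p.
  move=> /quot_pi_eq0 x0; apply/mem_pradical/(@multiplicator_nilp _ 1).
  by rewrite expr1.
apply: (quot_ring_isomorphic (J := lattice_ideal I)) => // x.
  move=> /subquot_frob_fixed Sx /pradicalP[n [y xn]]; apply/quot_pi_eq0.
  apply: (frob_fixed_nilp (n := n) p_pr Sx); rewrite -quot_piX xn.
  apply/quot_pi_eq0; rewrite unfold_in /lattice_ideal rmorphM rmorph_nat.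
  by rewrite char_multiplicator //; exact: valP.
have [s s_full] := finite_quot.
have [c [Sx [n]]] := frob_fixed_decomp p_pr char_quot (\pi_Q x) s_full.
rewrite -quot_piX -quot_piB => /multiplicator_nilp/mem_pradical xy.
by exists (x ^+ (p ^ c.+1)); split=> //; apply/subquot_frob_fixed; rewrite quot_piX.
Qed.

Lemma lattice_order_exists :
  exists O : nfOrder K, O =i addset (intmult K 1) I.
Proof.
have [I0 IB] := lattice_zmod_closed I.
have intI (k : int) x : x \in I -> k%:~R * x \in I.
  by move=> Ix; rewrite multiplicator_absorb // rpred_int.
have [A defA] : exists A : subringClosed K, A =i addset (intmult K 1) I.
  apply: subring_of_pred; split=> [|_ _ /asboolP[_ [x [/asboolP[k ->] Ix ->]]]
      /asboolP[_ [y [/asboolP[l ->] Iy ->]]]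
    |_ _ /asboolP[_ [x [/asboolP[k ->] Ix ->]]]
      /asboolP[_ [y [/asboolP[l ->] Iy ->]]]]; apply/asboolP.
  - exists 1, 0; split; rewrite ?addr0 //.
    by apply/asboolP; exists 1.
  - exists ((k - l)%:~R), (x - y); split; last 1 first.
    + by rewrite !mul1r rmorphB /=; ring.
    + by apply/asboolP; exists (k - l); rewrite mul1r.
    + exact: IB.
  (* The product (k + x)(l + y), with its integer part k l split off. *)
  - exists ((k * l)%:~R), (k%:~R * y + l%:~R * x + x * y); split; last 1 first.
    + by rewrite !mul1r rmorphM /=; ring.
    + by apply/asboolP; exists (k * l); rewrite mul1r.
    + by rewrite !lattice_addr ?intI ?mulI.
have sIA : {subset I <= A}.
  move=> x Ix; rewrite defA; apply/asboolP; exists 0, x; rewrite add0r; split=> //.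
  by apply/asboolP; exists 0; rewrite mulr0.
have sAM : {subset A <= M}.
  move=> y; rewrite defA => /asboolP[_ [x [/asboolP[k ->] Ix ->]]].
  by rewrite rpredD ?rpred_int // lattice_sub_multiplicator.
by exists (NfOrder (between_full_lattice sIA sAM)).
Qed.

Lemma lattice_order_sub_O_I : {subset addset (intmult K 1) I <= O_I}.
Proof.
move=> _ /asboolP[_ [x [/asboolP[k ->] Ix ->]]].
by rewrite rpredD ?rpred_int // sIO.
Qed.

(** By [Jp_eq_iff] any ring between Z + I and O_I qualifies. The join is the intersection of all
    qualifying orders above both O and O'; it lies in O_I because O_I is one of them. The meet is O
    ∩ O'. *)
Lemma orders_form_lattice :
  forms_lattice (fun O O' : nfOrder K => {subset O <= O'})
    (fun O : nfOrder K => Jp p O =i I).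
Proof.
have order_of (A : subringClosed K) : {subset addset (intmult K 1) I <= A} ->
    {subset A <= O_I} -> exists2 O : nfOrder K, Jp p O =i I & O =i A.
  move=> sZIA sAO; have sIA : {subset I <= A}.
    move=> x Ix; apply: sZIA; apply/asboolP; exists 0, x; split=> //.
      by apply/asboolP; exists 0; rewrite mulr0.
    by rewrite add0r.
  have sAM : {subset A <= M} by move=> x /sAO/sOM.
  by exists (NfOrder (between_full_lattice sIA sAM)) => //; apply/Jp_eq_iff.
split; first by exists O_I; exact: Jp_O_I.
move=> O O' /Jp_eq_iff[sZO sO] /Jp_eq_iff[sZO' sO']; split.
  have [A defA] : exists A : subringClosed K, A =i (fun x => `[< forall B : nfOrder K,
      Jp p B =i I -> {subset O <= B} -> {subset O' <= B} -> x \in B >]).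
    apply: subring_of_pred; split=> [|x y /asboolP Ax /asboolP Ay
      |x y /asboolP Ax /asboolP Ay]; apply/asboolP => B CB sB sB'.
    - exact: rpred1.
    - by rewrite rpredB ?Ax ?Ay.
    - by rewrite rpredM ?Ax ?Ay.
  have sOA : {subset O <= A}.
    by move=> x Ox; rewrite defA; apply/asboolP => B _ sB _; apply: sB.
  have [|x|J CJ JA] := order_of A; first by move=> x /sZO/sOA.
    by rewrite defA => /asboolP; apply=> //; exact: Jp_O_I.
  exists J; split=> // x.
  - by rewrite JA; apply: sOA.
  - by rewrite JA defA => O'x; apply/asboolP => B _ _ sB; apply: sB.
  - by move=> CB sB sB' y; rewrite JA defA => /asboolP; apply.
have [A defA] : exists A : subringClosed K, A =i [predI O & O'].
  apply: subring_of_pred; split=> [|x y /andP[Ox O'x] /andP[Oy O'y]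
    |x y /andP[Ox O'x] /andP[Oy O'y]].
  - by rewrite inE !rpred1.
  - by rewrite inE !rpredB.
  - by rewrite inE !rpredM.
have [x Zx|x|L CL LA] := order_of A.
- by rewrite defA inE sZO ?sZO'.
- by rewrite defA => /andP[/sO].
exists L; split=> // [x|x|B CB sB sB' x Bx]; rewrite LA defA.
- by case/andP.
- by case/andP.
- by rewrite inE sB ?sB'.
Qed.

End RadicalLattice.

Theorem theorem3p1 (K : fieldExtType rat) (p : nat) (hp : prime p)
    (I : fullLattice K) :
  ((exists O : nfOrder K, Jp p O =i I) <->
   ({subset addset (intmult K p) (lattice_mul I I) <= I} /\
    {subset I <= Jp p (ring_of_integers K)})) /\
  ({subset addset (intmult K p) (lattice_mul I I) <= I} ->
   {subset I <= Jp p (ring_of_integers K)} ->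
   exists O_I : nfOrder K,
     (is_O_I I O_I /\ forall O : nfOrder K, is_O_I I O -> O =i O_I) /\
     [/\ (exists2 O : nfOrder K, O =i addset (intmult K 1) I & Jp p O =i I),
         Jp p O_I =i I,
         ring_isomorphic
           (quot_ring (pradical (subring_of (multiplicator I)) p))
           (subring_of (subquot I O_I)),
         (forall O : nfOrder K, Jp p O =i I <->
            {subset addset (intmult K 1) I <= O} /\ {subset O <= O_I})
       & forms_lattice (fun O O' : nfOrder K => {subset O <= O'})
           (fun O : nfOrder K => Jp p O =i I)]).
Proof.
have [I0 IB] := lattice_zmod_closed I.
have cond_pI : {subset addset (intmult K p) (lattice_mul I I) <= I} -> p%:R \in I.
  move=> sI; apply: sI; apply/asboolP; exists p%:R, 0; rewrite addr0; split=> //.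
    by apply/asboolP; exists 1; rewrite mulr1.
  apply/asboolP; exists 0%N, [tuple]; split=> //.
  by exists [ffun=> 0]; rewrite big_ord0.
have cond_mul : {subset addset (intmult K p) (lattice_mul I I) <= I} ->
    forall x y, x \in I -> y \in I -> x * y \in I.
  move=> sI x y Ix Iy; apply: sI; apply/asboolP; exists 0, (x * y).
  rewrite add0r; split=> //; first by apply/asboolP; exists 0; rewrite mulr0.
  apply/asboolP; exists 1%N, [tuple x * y]; split; last exact/mem_intSpan/mem_head.
  by move=> z; rewrite inE => /eqP->; apply/asboolP; exists x, y.
split=> [|sI sIN]; last first.
  have pI := cond_pI sI; have mulI := cond_mul sI.
  have [O_I [sIO sOM OIP]] := exists_frob_fixed_order hp pI mulI.
  have JpO := Jp_eq_iff hp pI mulI sIN sIO sOM OIP.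
  exists O_I; split.
    split; first exact: frob_fixed_is_O_I hp pI _ sIO sOM OIP.
    by move=> O; apply: is_O_I_unique hp pI _ sIO sOM OIP _.
  split.
  - have [O defO] := lattice_order_exists hp pI mulI.
    exists O => //; apply/JpO; split=> x; first by rewrite defO.
    by rewrite defO; apply: lattice_order_sub_O_I.
  - exact: Jp_O_I hp pI mulI sIN _ sIO sOM OIP.
  - exact: multiplicator_pradical_quotient hp pI mulI sIN _ sIO OIP.
  - exact: JpO.
  - exact: orders_form_lattice hp pI mulI sIN _ sIO sOM OIP.
split=> [[O JpO]|[sI sIN]]; last first.
  have [O_I [sIO sOM OIP]] := exists_frob_fixed_order hp (cond_pI sI) (cond_mul sI).
  exists O_I; exact: Jp_O_I hp (cond_pI sI) (cond_mul sI) sIN _ sIO sOM OIP.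
have [O_lat _] := order_full O; have sOZ := lattice_ring_integral O_lat.
split=> [_ /asboolP[_ [x [/asboolP[k ->] /asboolP[n [s [sII sx]]] ->]]]|x].
  have Ix : x \in I.
    (* For a generator y z of I^2, y lies in J_p(O) and hence in O, while z lies in the ideal J_p(O)
       = I. *)
    apply: (intSpan_min (lattice_zmod_closed I)) sx => _ /sII/asboolP[y [z [Iy Iz ->]]].
    by rewrite -JpO Jp_absorb ?JpO //; apply: (@Jp_sub _ p); rewrite JpO.
  apply: lattice_addr => //.
  by rewrite -JpO mulrC rmorphM /= Jp_absorb ?rpred_int //; exact: Jp_char.
by rewrite -JpO => /(Jp_integral sOZ)[].
Qed.
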